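(* Let $B = (X, \{(U_i,V_i)\}_{i=1}^{\ell})$ be a BCS with contexts. Then $\mathscr{A}(B)$ is the quotient of $\mathscr{A}_{con}(B)$ by the relations $P_R(S) = -1$ for all constraints $C = (S,R) \in V_i$, $1 \leq i \leq \ell$. (That is, the two-sided ideal of $\mathscr{A}_{con}(B)$ defining $\mathscr{A}(B)$ coincides with the two-sided ideal generated by the elements $1 + P_R(S)$.)
   Context: Booleans are written multiplicatively: $-1$ is TRUE and $1$ is FALSE. A boolean relation of arity $k\ge 1$ is a subset $R\subseteq\{\pm1\}^k$; its indicator function is $f_R:\{\pm1\}^k\to\{\pm1\}$ with $f_R(v)=-1$ if $v\in R$ and $f_R(v)=1$ otherwise. A constraint on a finite set of variables $X$ is a pair $C=(S,R)$, where the scope $S=(s_1,\dots,s_k)$ is a sequence (of length $k\geq 1$) over $X\cup\{\pm1\}$ (repetitions and constants allowed) and $R$ is a $k$-ary relation. A boolean constraint system (BCS) is a pair $(X,\{C_i\}_{i=1}^m)$ with $X$ a finite set of variables and the $C_i$ constraints on $X$. An assignment to $X$ is a function $\phi:X\to\{\pm1\}$, extended to constants by the identity; $\phi(S)=(\phi(s_1),\dots,\phi(s_k))$; $\phi$ is satisfying if $\phi(S)\in R$ for every constraint $(S,R)$, and non-satisfying otherwise. A BCS with contexts is a tuple $B=(X,\{(U_i,V_i)\}_{i=1}^\ell)$ where $X$ is a finite set of variables, $U_i\subseteq X$, and $(U_i,V_i)$ is a BCS on the variables $U_i$ (with $V_i$ its set of constraints). $\mathscr{A}_{con}(B)$ is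 the unital complex $*$-algebra generated by $X$ subject to (1) $x^2=1$, $x^*=x$ for $x\in X$; (2) $xy=yx$ for $x,y\in U_i$, $1\le i\le\ell$. For an assignment $\phi$ to $U_i$ put $\Pi_{U_i,\phi}=\prod_{x\in U_i}\frac12(1+\phi(x)x)$. The BCS algebra $\mathscr{A}(B)$ is the quotient of $\mathscr{A}_{con}(B)$ by the relations (3) $\Pi_{U_i,\phi}=0$ for all $1\le i\le\ell$ and all non-satisfying assignments $\phi$ to $(U_i,V_i)$. For a $k$-ary relation $R$, $P_R$ is the element $P_R=\sum_{v\in\{\pm1\}^k} f_R(v)\prod_{i=1}^k\frac{1+v_iz_i}{2}$, a polynomial in commuting variables $z_1,\dots,z_k$ with $z_i^2=1$. For a constraint $(S,R)\in V_i$ with $S=(s_1,\dots,s_k)$, $P_R(S)$ is the element of $\mathscr{A}_{con}(B)$ obtained by substituting $s_j$ for $z_j$, $1\le j\le k$ (this makes sense as the variables in $S$ lie in $U_i$ and so commute). *)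

(* Defs.v *)
From HB Require Import structures.
From mathcomp Require Import all_boot all_order all_algebra.
From mathcomp Require Import generic_quotient ring_quotient finmap.
From mathcomp Require Import boolp classical_sets.
From mathcomp.multinomials Require Import monalg.

Set Implicit Arguments.
Unset Strict Implicit.
Unset Printing Implicit Defensive.

Import GRing.Theory Num.Theory.

Local Open Scope ring_scope.
Local Open Scope quotient_scope.

(* Unital *-algebras over C, with the C-algebra structure given by its unit
   map, a ring morphism from C to the centre; the scalar multiple of a by c is
   scalar c * a. GRing.Algebra is not usable here: it requires 1 != 0, whereas
   the algebra of a boolean constraint system may well be zero. *)
HB.mixin Record isStarAlgebra (C : numClosedFieldType) A of GRing.PzRing A := {
  scalar : C -> A;
  scalar_is_zmod_morphism : zmod_morphism scalar;
  scalar_is_monoid_morphism : monoid_morphism scalar;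
  scalarC : forall (c : C) (a : A), scalar c * a = a * scalar c;
  star : A -> A;
  starK : involutive star;
  starD : {morph star : a b / a + b};
  starM : {morph star : a b / a * b >-> b * a};
  star_scalar : forall c : C, star (scalar c) = scalar c^*
}.

#[short(type="starAlgType")]
HB.structure Definition StarAlgebra (C : numClosedFieldType) :=
  {A of GRing.PzRing A & isStarAlgebra C A}.

Arguments scalar {C A} c : rename.

Section StarAlgebraTheory.
Context {C : numClosedFieldType} {A : starAlgType C}.

HB.instance Definition _ :=
  GRing.isZmodMorphism.Build C A scalar scalar_is_zmod_morphism.
HB.instance Definition _ :=
  GRing.isMonoidMorphism.Build C A scalar scalar_is_monoid_morphism.

Lemma starN (a : A) : star (- a) = - star a.
Proof.
have s0 : star (0 : A) = 0.
  by apply: (@addrI _ (star 0)); rewrite -starD !addr0.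
by apply: (@addrI _ (star a)); rewrite -starD !subrr s0.
Qed.

End StarAlgebraTheory.

Section Ideals.
Context {C : numClosedFieldType} {A : starAlgType C}.
Implicit Types (I G : set A).

(* Stability under scalars is the stability under products with scalar c. *)
Definition two_sided_ideal I : Prop :=
  [/\ I 0, (forall a b, I a -> I b -> I (a + b)),
      (forall a b, I b -> I (a * b)) & (forall a b, I a -> I (a * b))].

Definition star_ideal I : Prop :=
  two_sided_ideal I /\ (forall a, I a -> I (star a)).

Definition ideal_gen G : set A := smallest two_sided_ideal G.
Definition star_ideal_gen G : set A := smallest star_ideal G.

Lemma ideal_gen_ideal G : two_sided_ideal (ideal_gen G).
Proof.
split.
- by move=> I [[h _ _ _] _].
- by move=> a b ha hb I hI; have [[_ h _ _] _] := hI; apply: h;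
    [apply: ha|apply: hb].
- by move=> a b hb I hI; have [[_ _ h _] _] := hI; apply: h; apply: hb.
- by move=> a b ha I hI; have [[_ _ _ h] _] := hI; apply: h; apply: ha.
Qed.

Lemma star_ideal_gen_ideal G : star_ideal (star_ideal_gen G).
Proof.
split; first split.
- by move=> I [[[h _ _ _] _] _].
- by move=> a b ha hb I hI; have [[[_ h _ _] _] _] := hI; apply: h;
    [apply: ha|apply: hb].
- by move=> a b hb I hI; have [[[_ _ h _] _] _] := hI; apply: h; apply: hb.
- by move=> a b ha I hI; have [[[_ _ _ h] _] _] := hI; apply: h; apply: ha.
- by move=> a ha I hI; have [[_ h] _] := hI; apply: h; apply: ha.
Qed.

End Ideals.

Section StarQuotient.
Context {C : numClosedFieldType} {A : starAlgType C}.
Variable G : set A.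

Definition star_ideal_pred : {pred A} := fun a => `[< star_ideal_gen G a >].

Let J (a : A) : (a \in star_ideal_pred) <-> star_ideal_gen G a.
Proof. by split=> [/asboolP|/asboolP]. Qed.

Lemma star_ideal_pred_closed : zmod_closed star_ideal_pred.
Proof.
have [[h0 hD hl _] _] := star_ideal_gen_ideal G.
split=> [|a b /J ha /J hb]; apply/J => //.
by apply: hD => //; rewrite -mulN1r; apply: hl.
Qed.

HB.instance Definition _ :=
  GRing.isZmodClosed.Build A star_ideal_pred star_ideal_pred_closed.

(* The *-algebra quotient of A by the relations g = 0 for g in G. *)
Definition star_quot : Type := Quotient.quot star_ideal_pred.

HB.instance Definition _ := GRing.Zmodule.on star_quot.

Definition star_pi (a : A) : star_quot :=
  \pi_(Quotient.quot star_ideal_pred) a.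

Lemma star_pi_eq (a b : A) :
  star_pi a = star_pi b <-> star_ideal_gen G (a - b).
Proof.
rewrite -J Quotient.idealrBE.
by split=> [h|/eqP //]; apply/eqP.
Qed.

Definition star_repr (q : star_quot) : A :=
  repr (q : Quotient.quot star_ideal_pred).

Lemma star_reprK : cancel star_repr star_pi.
Proof. exact: reprK. Qed.

Let piK (a : A) : star_ideal_gen G (star_repr (star_pi a) - a).
Proof. by apply/star_pi_eq; rewrite star_reprK. Qed.

Lemma star_pi_is_zmod_morphism : zmod_morphism star_pi.
Proof. exact: pi_is_zmod_morphism. Qed.

HB.instance Definition _ :=
  GRing.isZmodMorphism.Build A star_quot star_pi star_pi_is_zmod_morphism.

Definition quot_one : star_quot := star_pi 1.
Definition quot_mul (p q : star_quot) : star_quot :=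
  star_pi (star_repr p * star_repr q).

Let pi_mul (a b : A) : quot_mul (star_pi a) (star_pi b) = star_pi (a * b).
Proof.
have [[_ hD hl hr] _] := star_ideal_gen_ideal G.
apply/star_pi_eq; set a' := star_repr _; set b' := star_repr _.
have -> : a' * b' - a * b = (a' - a) * b' + a * (b' - b).
  by rewrite mulrBl mulrBr addrA subrK.
by apply: hD; [exact: hr (piK a)|exact: hl (piK b)].
Qed.

Let piP (P : star_quot -> Prop) : (forall a, P (star_pi a)) -> forall q, P q.
Proof. by move=> h q; rewrite -(star_reprK q). Qed.

Let quot_mulA : associative quot_mul.
Proof.
by apply: piP => a; apply: piP => b; apply: piP => c; rewrite !pi_mul mulrA.
Qed.

Let quot_mul1 : left_id quot_one quot_mul.
Proof. by apply: piP => a; rewrite pi_mul mul1r. Qed.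

Let quot_mulr1 : right_id quot_one quot_mul.
Proof. by apply: piP => a; rewrite pi_mul mulr1. Qed.

Let quot_mulDl : left_distributive quot_mul +%R.
Proof.
apply: piP => a; apply: piP => b; apply: piP => c.
by rewrite -raddfD !pi_mul mulrDl raddfD.
Qed.

Let quot_mulDr : right_distributive quot_mul +%R.
Proof.
apply: piP => a; apply: piP => b; apply: piP => c.
by rewrite -raddfD !pi_mul mulrDr raddfD.
Qed.

HB.instance Definition _ := GRing.Zmodule_isPzRing.Build star_quot
  quot_mulA quot_mul1 quot_mulr1 quot_mulDl quot_mulDr.

Lemma star_pi_is_monoid_morphism : monoid_morphism star_pi.
Proof. by split=> // a b; rewrite -pi_mul. Qed.

HB.instance Definition _ :=
  GRing.isMonoidMorphism.Build A star_quot star_pi star_pi_is_monoid_morphism.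

Definition quot_scalar (c : C) : star_quot := star_pi (scalar c).
Definition quot_star (q : star_quot) : star_quot :=
  star_pi (star (star_repr q)).

Let quot_scalar_zmod : zmod_morphism quot_scalar.
Proof. by move=> c d; rewrite /quot_scalar !rmorphB. Qed.

Let quot_scalar_monoid : monoid_morphism quot_scalar.
Proof.
by split=> [|c d]; rewrite /quot_scalar ?rmorph1 // !rmorphM.
Qed.

Let quot_scalarC (c : C) (q : star_quot) : quot_scalar c * q = q * quot_scalar c.
Proof.
by move: q; apply: piP => a; rewrite /quot_scalar -!rmorphM scalarC.
Qed.

Let pi_star (a : A) : quot_star (star_pi a) = star_pi (star a).
Proof.
have [_ hs] := star_ideal_gen_ideal G.
by apply/star_pi_eq; rewrite -starN -starD; exact: hs (piK a).
Qed.

Let quot_starK : involutive quot_star.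
Proof. by apply: piP => a; rewrite !pi_star starK. Qed.

Let quot_starD : {morph quot_star : a b / a + b}.
Proof.
apply: piP => a; apply: piP => b.
by rewrite -rmorphD !pi_star starD rmorphD.
Qed.

Let quot_starM : {morph quot_star : a b / a * b >-> b * a}.
Proof.
apply: piP => a; apply: piP => b.
by rewrite -rmorphM !pi_star starM rmorphM.
Qed.

Let quot_star_scalar (c : C) : quot_star (quot_scalar c) = quot_scalar c^*.
Proof. by rewrite /quot_scalar pi_star star_scalar. Qed.

HB.instance Definition _ := isStarAlgebra.Build C star_quot
  quot_scalar_zmod quot_scalar_monoid quot_scalarC
  quot_starK quot_starD quot_starM quot_star_scalar.

Lemma star_pi_scalar (c : C) : star_pi (scalar c) = scalar c.
Proof. by []. Qed.

Lemma star_pi_star (a : A) : star_pi (star a) = star (star_pi a).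
Proof. by rewrite -pi_star. Qed.

Lemma star_pi_surj (q : star_quot) : exists a, star_pi a = q.
Proof. by exists (star_repr q); apply: star_reprK. Qed.

Lemma star_pi_eq0 (a : A) : star_pi a = 0 <-> star_ideal_gen G a.
Proof. by rewrite -(rmorph0 star_pi) star_pi_eq subr0. Qed.

End StarQuotient.

Section IsQuotient.
Context {C : numClosedFieldType} {A Q : starAlgType C}.

Definition star_hom (f : A -> Q) : Prop :=
  [/\ f 1 = 1, {morph f : a b / a + b}, {morph f : a b / a * b},
      (forall c : C, f (scalar c) = scalar c) & {morph f : a / star a}].

(* f exhibits Q as the quotient of A by the relations g = 0 for g in G. *)
Definition is_star_quotient (G : set A) (f : A -> Q) : Prop :=
  [/\ star_hom f, (forall q, exists a, f a = q) &
      forall a, f a = 0 <-> star_ideal_gen G a].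

End IsQuotient.

(* The free unital *-algebra on X: noncommutative polynomials in the letters
   (x, false) and (x, true), standing for x and x^* respectively. *)
Section FreeStarAlgebra.
Variables (C : numClosedFieldType) (X : choiceType).

Definition free_star_alg : Type := {malg C[{fmonom (X * bool)%type}]}.

HB.instance Definition _ := GRing.NzRing.on free_star_alg.

Definition star_letter (l : (X * bool)%type) : (X * bool)%type := (l.1, ~~ l.2).

Definition star_word (w : {fmonom (X * bool)%type}) : {fmonom (X * bool)%type} :=
  FMonom (rev (map star_letter w)).

Definition free_scalar (c : C) : free_star_alg := c%:MP.

Definition free_star (g : free_star_alg) : free_star_alg :=
  \sum_(w <- msupp g) << (g@_w)^* *g star_word w >>.

Definition free_gen (x : X) : free_star_alg := << fmu (x, false) >>.

Lemma star_wordK : involutive star_word.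
Proof.
case=> s; rewrite /star_word /= map_rev revK -map_comp.
by rewrite map_id_in // => -[x b] _; rewrite /star_letter /= negbK.
Qed.

Lemma star_wordM (v w : {fmonom (X * bool)%type}) :
  star_word (mmul v w) = mmul (star_word w) (star_word v).
Proof. by apply/val_inj; rewrite /= fmM !fmM /= map_cat rev_cat. Qed.

Lemma mcoeff_free_star (g : free_star_alg) w :
  (free_star g)@_w = (g@_(star_word w))^*.
Proof.
rewrite [in RHS](monalgE g) /free_star !raddf_sum /=.
apply: eq_bigr => v _; rewrite !mcoeffU.
by rewrite (can2_eq star_wordK star_wordK) rmorphMn.
Qed.

Let free_scalar_zmod : zmod_morphism free_scalar.
Proof. exact: rmorphB. Qed.

Let free_scalar_monoid : monoid_morphism free_scalar.
Proof. by split; [apply: rmorph1|apply: rmorphM]. Qed.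

Let free_scalarC (c : C) (g : free_star_alg) :
  free_scalar c * g = g * free_scalar c.
Proof.
rewrite [LHS]malgM_def [RHS]malgM_def fgmulUg fgmulgU.
by apply: eq_bigr => w _; rewrite mulrC mul1m mulm1.
Qed.

Let free_starK : involutive free_star.
Proof.
by move=> g; apply/malgP => w; rewrite !mcoeff_free_star star_wordK conjCK.
Qed.

Let free_starD : {morph free_star : g h / g + h}.
Proof.
by move=> g h; apply/malgP => w;
  rewrite !(mcoeff_free_star, mcoeffD) rmorphD.
Qed.

Let free_starU (c : C) w : free_star << c *g w >> = << c^* *g star_word w >>.
Proof.
apply/malgP => v; rewrite mcoeff_free_star !mcoeffU rmorphMn /=.
by rewrite (can2_eq star_wordK star_wordK).
Qed.

Let free_star_sum (T : Type) (r : seq T) (F : T -> free_star_alg) :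
  free_star (\sum_(i <- r) F i) = \sum_(i <- r) free_star (F i).
Proof.
apply: (big_morph free_star free_starD).
by apply/malgP => w; rewrite mcoeff_free_star !mcoeff0 conjC0.
Qed.

Let free_starM : {morph free_star : g h / g * h >-> h * g}.
Proof.
move=> g h; rewrite [g * h]malgME exchange_big free_star_sum.
rewrite [in RHS]/free_star mulr_suml; apply: eq_bigr => w _.
rewrite free_star_sum mulr_sumr; apply: eq_bigr => v _.
rewrite free_starU rmorphM star_wordM mulrC.
by rewrite [RHS]malgM_def fgmulUU.
Qed.

Let free_star_scalar (c : C) : free_star (free_scalar c) = free_scalar c^*.
Proof.
rewrite [LHS]free_starU; congr (<< _ *g _ >>).
by apply/val_inj; rewrite /= fm1.
Qed.

HB.instance Definition _ := isStarAlgebra.Build C free_star_alg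
  free_scalar_zmod free_scalar_monoid free_scalarC
  free_starK free_starD free_starM free_star_scalar.

End FreeStarAlgebra.

(* Signs: the boolean b stands for (-1) ^+ b, so that -1 is TRUE. *)

Definition bool_rel (k : nat) := {set k.-tuple bool}.

Definition indicator (k : nat) (R : bool_rel k) (v : k.-tuple bool) : bool :=
  v \in R.

Section BooleanConstraintSystems.
Variable X : finType.

Record constraint := Constraint {
  arity : nat;
  arity_gt0 : (0 < arity)%N;
  scope : arity.-tuple (X + bool)%type;
  rel_of : bool_rel arity
}.

Record bcs := BCS {
  nconstraints : nat;
  constraint_of :> 'I_nconstraints -> constraint
}.

Definition assignment := {ffun X -> bool}.

Definition extend (phi : assignment) (s : (X + bool)%type) : bool :=
  match s with inl x => phi x | inr b => b end.

Definition satisfying (B : bcs) (phi : assignment) : Prop :=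
  forall j : 'I_(nconstraints B),
    map_tuple (extend phi) (scope (B j)) \in rel_of (B j).

End BooleanConstraintSystems.

Record bcs_with_contexts (X : finType) := BCSWithContexts {
  ncontexts : nat;
  context : 'I_ncontexts -> {set X};
  context_bcs : forall i : 'I_ncontexts, bcs {x : X | x \in context i}
}.

Section BCSAlgebra.
Variables (C : numClosedFieldType) (X : finType) (B : bcs_with_contexts X).

Definition con_relations : set (free_star_alg C X) :=
  [set r | [\/ exists x : X, r = free_gen C x * free_gen C x - 1,
               exists x : X, r = star (free_gen C x) - free_gen C x |
               exists (i : 'I_(ncontexts B)) (x y : X),
                 [/\ x \in context i, y \in context i &
                     r = free_gen C x * free_gen C y
                         - free_gen C y * free_gen C x]]].

Definition con_alg : Type := star_quot con_relations.
HB.instance Definition _ := StarAlgebra.on con_alg.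

Definition con_gen (x : X) : con_alg := star_pi con_relations (free_gen C x).

Definition sgn (A : starAlgType C) (b : bool) : A := (-1) ^+ b.

(* The factors commute, so the order of the product is immaterial. *)
Definition context_proj (i : 'I_(ncontexts B))
    (phi : assignment {x : X | x \in context i}) : con_alg :=
  \prod_x (scalar 2^-1 * (1 + sgn con_alg (phi x) * con_gen (val x))).

Definition nonsat_relations : set con_alg :=
  [set r | exists (i : 'I_(ncontexts B))
             (phi : assignment {x : X | x \in context i}),
      ~ satisfying (context_bcs i) phi /\ r = context_proj phi].

Definition bcs_alg : Type := star_quot nonsat_relations.
HB.instance Definition _ := StarAlgebra.on bcs_alg.

Definition bcs_pi : con_alg -> bcs_alg := star_pi nonsat_relations.

(* P_R evaluated at z_1, .., z_k. *)
Definition relation_poly (A : starAlgType C) (k : nat) (R : bool_rel k)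
    (z : 'I_k -> A) : A :=
  \sum_(v : k.-tuple bool) sgn A (indicator R v)
    * \prod_(j < k) (scalar 2^-1 * (1 + sgn A (tnth v j) * z j)).

Definition scope_val (i : 'I_(ncontexts B))
    (s : ({x : X | x \in context i} + bool)%type) : con_alg :=
  match s with inl x => con_gen (val x) | inr b => sgn con_alg b end.

(* P_R(S). *)
Definition constraint_poly (i : 'I_(ncontexts B))
    (c : constraint {x : X | x \in context i}) : con_alg :=
  relation_poly (rel_of c) (fun j => scope_val (tnth (scope c) j)).

(* The relations P_R(S) = -1. *)
Definition constraint_relations : set con_alg :=
  [set r | exists (i : 'I_(ncontexts B))
             (j : 'I_(nconstraints (context_bcs i))),
      r = 1 + constraint_poly (context_bcs i j)].

End BCSAlgebra.

Arguments con_relations C {X} B.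
Arguments nonsat_relations C {X} B.
Arguments bcs_pi C {X} B.
Arguments constraint_relations C {X} B.

(* Main.v *)
(* On the context [U_i], the elements [Pi_phi] sum to 1 and are joint
   eigenvectors: [s * Pi_phi = phi(s) Pi_phi] for every entry [s] of a scope.
   Hence [P_R(S) * Pi_phi = f_R(phi(S)) Pi_phi], so that [(1 + P_R(S)) * Pi_phi]
   is [2 Pi_phi] if [phi] violates [(S, R)] and [0] otherwise. A non-satisfying
   [phi] violates some [(S, R)], so [Pi_phi] is in the ideal of the
   [1 + P_R(S)]; conversely [1 + P_R(S)] is twice the sum of the [Pi_phi] over
   the [phi] violating [(S, R)]. Since the [Pi_phi] are self-adjoint, the ideal
   is star-stable. *)

Require Import Defs.
From HB Require Import structures.
From mathcomp Require Import all_boot all_order all_algebra.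
From mathcomp Require Import classical_sets reals complex.
From mathcomp Require boolp.

Local Open Scope classical_set_scope.
Local Open Scope ring_scope.

Set Implicit Arguments.
Unset Strict Implicit.
Unset Printing Implicit Defensive.

Import GRing.Theory Num.Theory.
(* [scalar] also names a notation of ssralg. *)
Import Defs.

(** * Star-stability of two-sided ideals *)

Section StarAlgebraFacts.
Context {C : numClosedFieldType} {A : starAlgType C}.
Implicit Types (a : A) (G I : set A).

Lemma star1 : star (1 : A) = 1.
Proof. by rewrite -[LHS]mul1r -[X in X * _]starK -starM mul1r starK. Qed.

Lemma scalar_half_double a : scalar 2^-1 * (a + a) = a.
Proof.
rewrite -mulr2n -[a *+ 2]mulr_natl mulrA -(rmorph_nat (@scalar C A)) -rmorphM.
by rewrite mulVf ?pnatr_eq0 // rmorph1 mul1r.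
Qed.

Lemma star_sgn (b : bool) : star (sgn A b) = sgn A b.
Proof. by case: b; rewrite /sgn ?starN star1. Qed.

(** The involution reverses the product, and commutation restores the order. *)
Lemma star_prod_comm (T : eqType) (r : seq T) (F : T -> A) :
  (forall x y, GRing.comm (F x) (F y)) -> (forall x, star (F x) = F x) ->
  star (\prod_(x <- r) F x) = \prod_(x <- r) F x.
Proof.
move=> FC Fs; elim: r => [|x r IHr]; first by rewrite big_nil star1.
rewrite big_cons starM IHr Fs; apply/esym.
by apply: commr_prod => y _.
Qed.

Lemma two_sided_ideal_sum I (T : Type) (r : seq T) (P : pred T) (F : T -> A) :
  two_sided_ideal I -> (forall x, P x -> I (F x)) ->
  I (\sum_(x <- r | P x) F x).
Proof. by case=> I0 ID _ _ IF; elim/big_ind: _. Qed.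

Lemma ideal_gen_sub G I : two_sided_ideal I -> G `<=` I -> ideal_gen G `<=` I.
Proof. by move=> hI GI a; apply. Qed.

Lemma sub_ideal_gen G : G `<=` ideal_gen G.
Proof. by move=> a Ga I [_]; apply. Qed.

(** The preimage of a two-sided ideal under [star] is again one, left and right multiples being
    exchanged; so it is enough that it contains the generators. *)
Lemma ideal_gen_star_stable G :
  (forall a, G a -> ideal_gen G (star a)) ->
  forall a, ideal_gen G a -> ideal_gen G (star a).
Proof.
move=> Gs; have [I0 ID IMl IMr] := ideal_gen_ideal G.
apply: (@ideal_gen_sub G (fun a => ideal_gen G (star a))) => //.
split=> [|a b Ia Ib|a b Ib|a b Ia].
- suff -> : star (0 : A) = 0 by [].
  by rewrite -[X in star X](subrr 0) starD starN subrr.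
- by rewrite starD; apply: ID.
- by rewrite starM; apply: IMr.
- by rewrite starM; apply: IMl.
Qed.

(** A star-stable [ideal_gen G] competes in the intersection defining [star_ideal_gen G]; conversely
    each star-ideal is a two-sided ideal. *)
Lemma star_ideal_gen_star_stable G :
  (forall a, ideal_gen G a -> ideal_gen G (star a)) ->
  star_ideal_gen G = ideal_gen G.
Proof.
move=> Gs; rewrite eqEsubset; split=> a Ga.
  by apply: Ga; split; [split=> //; exact: ideal_gen_ideal|exact: sub_ideal_gen].
by move=> I [[hI _] GI]; apply: Ga.
Qed.

Lemma star_hom_pi G : star_hom (star_pi G).
Proof.
split=> [|a b|a b|c|a]; [exact: rmorph1|exact: rmorphD|exact: rmorphM| |].
- exact: star_pi_scalar.
- exact: star_pi_star.
Qed.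

End StarAlgebraFacts.

(** * Spectral projections of commuting involutions *)

Section SpectralProjections.
Context {C : numClosedFieldType} {A : starAlgType C}.
Implicit Types (p z : A) (b c : bool).

(** For [z * z = 1], the spectral projection of [z] for the eigenvalue [(-1) ^+ b]; the factors of
    [context_proj] and [relation_poly] have this form. *)
Definition sign_proj b z : A := scalar 2^-1 * (1 + sgn A b * z).

Lemma sign_projD z : sign_proj true z + sign_proj false z = 1.
Proof.
rewrite /sign_proj -mulrDr /sgn mulN1r mul1r addrACA [- z + z]addNr addr0.
exact: scalar_half_double.
Qed.

Lemma comm_sign_proj z b p : GRing.comm p z -> GRing.comm p (sign_proj b z).
Proof.
move=> pz; apply: commrM; first exact/esym/scalarC.
by apply: commrD; [exact: commr1|apply: commrM => //; exact: commr_sign].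
Qed.

Lemma star_sign_proj z b : star z = z -> star (sign_proj b z) = sign_proj b z.
Proof.
move=> zs; rewrite starM starD starM star1 star_sgn zs star_scalar.
have -> : (2^-1 : C)^* = 2^-1 by rewrite fmorphV rmorph_nat.
by rewrite -scalarC [z * _]commr_sign.
Qed.

Lemma mul_sign_proj z b : z * z = 1 -> z * sign_proj b z = sgn A b * sign_proj b z.
Proof.
move=> z2; rewrite /sign_proj mulrA -scalarC -mulrA [RHS]mulrA -scalarC -mulrA.
congr (_ * _); rewrite !mulrDr !mulr1 mulrA [z * sgn A b]commr_sign -mulrA z2.
by rewrite mulr1 mulrA /sgn -expr2 sqrr_sign mul1r addrC.
Qed.

(** On [p] the factor acts as the number [(1 + (-1) ^+ b * (-1) ^+ c) / 2], which is 1 or 0. *)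
Lemma sign_proj_eigen z p b c :
  z * p = sgn A c * p -> sign_proj b z * p = p *+ (b == c).
Proof.
move=> zp; rewrite /sign_proj -mulrA mulrDl mul1r -[_ * z * p]mulrA zp mulrA.
by case: b c {zp} => -[]; rewrite /sgn ?mulrNN ?mulrN ?mulr1 ?mulNr ?mul1r
  ?scalar_half_double // subrr mulr0.
Qed.

(** The product indexed by [u] fixes [p] if [u = v] and kills it otherwise, so only the term of [v]
    survives in the sum. *)
Lemma relation_poly_eigen k (R : bool_rel k) (w : 'I_k -> A) (v : k.-tuple bool) p :
  (forall j, w j * p = sgn A (tnth v j) * p) ->
  relation_poly R w * p = sgn A (indicator R v) * p.
Proof.
move=> wp.
have prodE u : (\prod_(j < k) sign_proj (tnth u j) (w j)) * p = p *+ (u == v).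
  (* Each factor keeps or kills [p], according to agreement of [u] and [v] at one coordinate. *)
  transitivity (p *+ all (fun j => tnth u j == tnth v j) (index_enum 'I_k)).
    elim: index_enum => [|j r IHr] /=; first by rewrite big_nil mul1r.
    rewrite big_cons -mulrA IHr mulrnAr (sign_proj_eigen _ (wp j)) -mulrnA.
    by rewrite mulnb.
  congr (_ *+ nat_of_bool _); apply/allP/eqP => [uv|-> //].
  by apply: eq_from_tnth => j; apply/eqP/uv; rewrite mem_index_enum.
rewrite /relation_poly mulr_suml (bigD1 v) //= -mulrA prodE eqxx.
rewrite big1 ?addr0 // => u /negPf uv.
by rewrite -mulrA prodE uv mulr0.
Qed.

Section Joint.
Context {I : finType} {z : I -> A}.
Hypothesis zC : forall x y, GRing.comm (z x) (z y).

Definition joint_proj (phi : {ffun I -> bool}) : A :=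
  \prod_x sign_proj (phi x) (z x).

Lemma sum_joint_proj : \sum_phi joint_proj phi = 1.
Proof.
(* By distributivity the sum is the product over [x] of the sums of the two projections of [z x]. *)
rewrite /joint_proj -(bigA_distr_bigA (fun x b => sign_proj b (z x))).
by apply: big1 => x _; rewrite big_bool; exact: sign_projD.
Qed.

Lemma star_joint_proj phi :
  (forall x, star (z x) = z x) -> star (joint_proj phi) = joint_proj phi.
Proof.
move=> zs; apply: star_prod_comm => [x y|x]; last exact: star_sign_proj.
by apply: comm_sign_proj; apply/commr_sym/comm_sign_proj.
Qed.

Lemma joint_proj_eigen phi x :
  z x * z x = 1 -> z x * joint_proj phi = sgn A (phi x) * joint_proj phi.
Proof.
move=> z2; have: x \in index_enum I by rewrite mem_index_enum.
(* [z x] commutes past the factors of other indices until it meets its own, which turns it into a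
   sign. *)
rewrite /joint_proj; elim: index_enum => [//|y r IHr].
rewrite inE big_cons (mulrA (z x)) (mulrA (sgn A _)); case: (eqVneq x y) => [<- _|_ /= xr].
  by rewrite mul_sign_proj.
rewrite [z x * _](comm_sign_proj (phi y) (zC x y)) -mulrA IHr // (mulrA (sign_proj _ _)).
by congr (_ * _); exact: commr_sign.
Qed.

End Joint.
End SpectralProjections.

(** * Comparison of the two ideals of the context algebra *)

Section BCSIdeals.
Variables (C : numClosedFieldType) (X : finType) (B : bcs_with_contexts X).
Local Notation A := (con_alg C B).

Lemma con_relation_eq (a b : free_star_alg C X) :
  con_relations C B (a - b) ->
  star_pi (con_relations C B) a = star_pi (con_relations C B) b.
Proof. by move=> ab; apply/star_pi_eq => I [_]; apply. Qed.

Lemma con_gen_sq x : con_gen C B x * con_gen C B x = 1.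
Proof.
rewrite /con_gen -rmorphM -[RHS](rmorph1 (star_pi (con_relations C B))).
by apply: con_relation_eq; apply: Or31; exists x.
Qed.

Lemma star_con_gen x : star (con_gen C B x) = con_gen C B x.
Proof.
rewrite /con_gen -star_pi_star.
by apply: con_relation_eq; apply: Or32; exists x.
Qed.

Lemma con_gen_comm (i : 'I_(ncontexts B)) x y :
  x \in context i -> y \in context i ->
  GRing.comm (con_gen C B x) (con_gen C B y).
Proof.
move=> xi yi; rewrite /GRing.comm /con_gen -!rmorphM.
by apply: con_relation_eq; apply: Or33; exists i, x, y.
Qed.

Section Context.
Variable i : 'I_(ncontexts B).
Local Notation U := {x : X | x \in context i}.
Implicit Type phi : assignment U.

Let con_gen_valC (x y : U) :
  GRing.comm (con_gen C B (val x)) (con_gen C B (val y)).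
Proof. exact: con_gen_comm (valP x) (valP y). Qed.

Lemma star_context_proj phi : star (context_proj C phi) = context_proj C phi.
Proof. by apply: (star_joint_proj con_gen_valC) => x; apply: star_con_gen. Qed.

Lemma sum_context_proj : \sum_(phi : assignment U) context_proj C phi = 1.
Proof. exact: sum_joint_proj. Qed.

Lemma scope_val_context_proj phi (s : U + bool) :
  scope_val C s * context_proj C phi
    = sgn A (extend phi s) * context_proj C phi.
Proof.
case: s => [x|//].
exact: (joint_proj_eigen con_gen_valC phi (con_gen_sq (val x))).
Qed.

Lemma constraint_poly_context_proj phi (c : constraint U) :
  constraint_poly C c * context_proj C phi
    = sgn A (map_tuple (extend phi) (scope c) \in rel_of c)
        * context_proj C phi.
Proof.
apply: relation_poly_eigen => j.
by rewrite tnth_map scope_val_context_proj.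
Qed.

End Context.

Lemma ideal_gen_nonsat_constraint :
  ideal_gen (nonsat_relations C B) = ideal_gen (constraint_relations C B).
Proof.
rewrite eqEsubset; split; apply: ideal_gen_sub; try exact: ideal_gen_ideal.
- move=> _ [i [phi [/boolp.existsNP [j nsat] ->]]].
  have [_ _ IMl IMr] := ideal_gen_ideal (constraint_relations C B).
  (* The violated constraint [j] has eigenvalue 1 on the projection, which is therefore half of
     [1 + P_R(S)] times itself. *)
  rewrite -[context_proj C phi]scalar_half_double; apply: IMl.
  have := constraint_poly_context_proj phi (context_bcs i j).
  rewrite (negPf (introN idP nsat)) /sgn mul1r => Pphi.
  rewrite -[X in X + _]mul1r -[X in _ + X]Pphi -mulrDl.
  by apply: IMr; apply: sub_ideal_gen; exists i, j.
- move=> _ [i [j ->]].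
  have hI := ideal_gen_ideal (nonsat_relations C B); have [I0 ID _ _] := hI.
  (* Multiplying by the sum of all context projections splits [1 + P_R(S)] into terms that are 0 or
     twice a non-satisfying projection. *)
  rewrite -[1 + _]mulr1 -[X in _ * X](sum_context_proj i) mulr_sumr.
  apply: two_sided_ideal_sum => // phi _.
  rewrite mulrDl mul1r constraint_poly_context_proj.
  case: (boolP (_ \in _)) => [_|nsat]; first by rewrite /sgn mulN1r subrr.
  rewrite /sgn mul1r; apply: ID; apply: sub_ideal_gen; exists i, phi;
    by split=> // /(_ j); apply/negP.
Qed.

Lemma star_ideal_gen_nonsat :
  star_ideal_gen (nonsat_relations C B) = ideal_gen (nonsat_relations C B).
Proof.
apply: star_ideal_gen_star_stable; apply: ideal_gen_star_stable.
move=> a [i [phi [nsat aE]]]; apply: sub_ideal_gen.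
by rewrite aE star_context_proj; exists i, phi.
Qed.

(** Star-stability is carried over from the ideal of the projections, with no need to compute the
    adjoint of [P_R(S)]. *)
Lemma star_ideal_gen_constraint :
  star_ideal_gen (constraint_relations C B)
    = ideal_gen (constraint_relations C B).
Proof.
apply: star_ideal_gen_star_stable; rewrite -ideal_gen_nonsat_constraint.
rewrite -star_ideal_gen_nonsat.
by have [] := star_ideal_gen_ideal (nonsat_relations C B).
Qed.

End BCSIdeals.

Theorem corollary3p6 (R : realType) (X : finType) (B : bcs_with_contexts X) :
  [/\ is_star_quotient (constraint_relations R[i] B) (bcs_pi R[i] B),
      [set a | bcs_pi R[i] B a = 0] = ideal_gen (constraint_relations R[i] B)
    & ideal_gen (nonsat_relations R[i] B)
        = ideal_gen (constraint_relations R[i] B)].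
Proof.
have pi0 a : bcs_pi R[i] B a = 0 <-> ideal_gen (constraint_relations R[i] B) a.
  rewrite -ideal_gen_nonsat_constraint -star_ideal_gen_nonsat.
  exact: star_pi_eq0.
split; last exact: ideal_gen_nonsat_constraint.
- split=> [|q|a]; [exact: star_hom_pi|exact: star_pi_surj|].
  by rewrite star_ideal_gen_constraint.
- by rewrite eqEsubset; split=> a /pi0.
Qed.
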